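(* Let $B\in\mathbb{C}^{m\times n}$, $\tilde W\in\mathbb{C}^{n\times m}$ and $\tilde k=\mathrm{ind}(B\tilde W)$. Let $X\in\mathbb{C}^{m\times n}$ be a minimal rank $W$-weighted weak Drazin inverse of $B$ and let $\mathfrak{D}=B+E\in\mathbb{C}^{m\times n}$. If $\mathcal R(E\tilde W)\subseteq\mathcal R((B\tilde W)^{\tilde k})$, $\mathcal R((E\tilde W)^* )\subseteq\mathcal R((X\tilde W B\tilde W)^* )$ and $\|\tilde W E\tilde W X\|<1$, then $X(I+\tilde W E\tilde W X)^{-1}$ is a minimal rank $W$-weighted weak Drazin inverse of $\mathfrak{D}$. Moreover, $$X(I+\tilde W E\tilde W X)^{-1}\tilde W\mathfrak{D}\tilde W=X\tilde W B\tilde W\qquad\text{and}\qquad \tilde W\mathfrak{D}\tilde W(I+X\tilde W E\tilde W)^{-1}X=\tilde W B\tilde W X.$$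
   Context: $\mathcal R(\cdot)$ denotes the range and $^*$ the conjugate transpose; $\|\cdot\|$ is a submultiplicative matrix norm. For a square complex matrix $T$, $\mathrm{ind}(T)$ is the smallest nonnegative integer $k$ with $\mathrm{rank}(T^k)=\mathrm{rank}(T^{k+1})$ (with $T^0=I$). For $A\in\mathbb{C}^{m\times n}$ and $k=\mathrm{ind}(A\tilde W)$, a matrix $X\in\mathbb{C}^{m\times n}$ is a minimal rank $W$-weighted weak Drazin inverse of $A$ (with respect to the weight $\tilde W$) if $X\tilde W(A\tilde W)^{k+1}=(A\tilde W)^{k}$ and $\mathrm{rank}(X)=\mathrm{rank}((A\tilde W)^{k})$. *)

(* Defs.v *)
From HB Require Import structures.
From mathcomp Require Import all_boot all_order all_algebra.
From mathcomp Require Import spectral.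
From mathcomp Require Import mathcomp_extra boolp classical_sets reals.
From mathcomp Require Import complex.

Set Implicit Arguments.
Unset Strict Implicit.
Unset Printing Implicit Defensive.

Import Order.TTheory GRing.Theory Num.Theory.
Local Open Scope classical_set_scope.
Local Open Scope ring_scope.
Local Open Scope complex_scope.
Local Open Scope sesquilinear_scope.

(* MathComp's (A <= B)%MS compares row spaces, hence a separate definition for
   the range, i.e. the set of all column vectors A *m x. *)
Definition mxrange (F : fieldType) (p q : nat) (A : 'M[F]_(p, q)) :
    set 'cV[F]_p :=
  range (fun x : 'cV[F]_q => A *m x).

Definition conj_trmx (R : realType) (p q : nat) (A : 'M[R[i]]_(p, q)) :
    'M[R[i]]_(q, p) :=
  A ^t*.

Lemma mxind_exists (F : fieldType) (m : nat) (T : 'M[F]_m) :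
  exists k : nat, \rank (T ^+ k) == \rank (T ^+ k.+1).
Proof.
apply: contrapT => noind.
have bound k : (\rank (T ^+ k) + k <= m)%N.
  elim: k => [|k IHk]; first by rewrite addn0 rank_leq_row.
  rewrite addnS; apply: leq_trans IHk; rewrite ltn_add2r ltn_neqAle.
  apply/andP; split; last by rewrite exprS -mulmxE mxrankM_maxr.
  by apply/negP => /eqP eq_rk; apply: noind; exists k; rewrite eq_rk.
by have := leq_trans (leq_addl _ _) (bound m.+1); rewrite ltnn.
Qed.

Definition mxind (F : fieldType) (m : nat) (T : 'M[F]_m) : nat :=
  ex_minn (mxind_exists T).

Definition min_rank_weighted_weak_Drazin (F : fieldType) (m n : nat)
    (W : 'M[F]_(n, m)) (A X : 'M[F]_(m, n)) : Prop :=
  let k := mxind (A *m W) in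
  X *m W *m (A *m W) ^+ k.+1 = (A *m W) ^+ k
  /\ \rank X = \rank ((A *m W) ^+ k).

Record submultiplicative_norm (R : realType) (n : nat)
    (N : 'M[R[i]]_n -> R) : Prop := SubmultiplicativeNorm {
  submul_norm_ge0 : forall A, 0 <= N A ;
  submul_norm_eq0 : forall A, N A = 0 -> A = 0 ;
  submul_normZ : forall (c : R[i]) A, N (c *: A) = Normc.normc c * N A ;
  submul_normD : forall A B, N (A + B) <= N A + N B ;
  submul_normM : forall A B, N (A *m B) <= N A * N B }.

(* Main.v *)
(** With [P = X W B W], the defining equations make [P] an idempotent whose
    range is that of [(B W)^k], which is also the range of [X]; the two range
    conditions say exactly that [P (E W) = E W = (E W) P].  Hence
    [D W = B W (1 + X W E W)] leaves that range invariant and agrees with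
    [B W] modulo it, so the powers of [D W] eventually have that range, on
    which [X (1 + W E W X)^-1 W = (1 + X W E W)^-1 X W] inverts [D W]. *)
Require Import Defs.
From mathcomp Require Import all_boot all_order all_algebra.
From mathcomp Require Import spectral.
From mathcomp Require Import classical_sets reals.
From mathcomp Require Import complex.

Set Implicit Arguments.
Unset Strict Implicit.
Unset Printing Implicit Defensive.

Import Order.TTheory GRing.Theory Num.Theory.
Local Open Scope classical_set_scope.
Local Open Scope ring_scope.
Local Open Scope complex_scope.

Lemma mxrange_sub_mulmx (F : fieldType) (m n p : nat)
    (A : 'M[F]_(m, n)) (B : 'M[F]_(m, p)) :
  mxrange A `<=` mxrange B -> exists C, A = B *m C.
Proof.
move=> sAB; suff /submxP[C eqC] : (A^T <= B^T)%MS.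
  by exists C^T; rewrite -[A]trmxK eqC trmx_mul trmxK.
apply/row_subP => j; rewrite -tr_col.
have [|x _ <-] := sAB (col j A); first by exists (delta_mx j 0); rewrite ?colE.
by rewrite trmx_mul submxMl.
Qed.

(** The column space of [A *m C] always lies in that of [A]; equal ranks make the two coincide. *)
Lemma mulmx_eq_rank_factor (F : fieldType) (m n p : nat)
    (A : 'M[F]_(m, n)) (C : 'M[F]_(n, p)) :
  \rank A = \rank (A *m C) -> exists Z, A = A *m C *m Z.
Proof.
move=> rkA; suff /submxP[Z eqZ] : (A^T <= (A *m C)^T)%MS.
  by exists Z^T; rewrite -[LHS]trmxK eqZ trmx_mul trmxK.
have sCA : ((A *m C)^T <= A^T)%MS by rewrite trmx_mul submxMl.
by rewrite -(geq_leqif (mxrank_leqif_sup sCA)) !mxrank_tr rkA.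
Qed.

Lemma mxind_factor (F : fieldType) (m : nat) (T : 'M[F]_m) :
  exists Z, T ^+ mxind T = T ^+ (mxind T).+1 *m Z.
Proof.
rewrite /mxind; case: ex_minnP => k /eqP rkT _.
by rewrite exprSr; apply: mulmx_eq_rank_factor; rewrite rkT exprSr.
Qed.

Lemma expr_factor_iter (R : pzRingType) (T Z : R) (k j : nat) :
  T ^+ k = T ^+ k.+1 * Z -> T ^+ k = T ^+ (j + k) * Z ^+ j.
Proof.
move=> eqT; elim: j => [|j IHj]; first by rewrite mulr1.
by rewrite {1}IHj exprD {1}eqT mulrA -exprD addnS -mulrA -exprS.
Qed.

Lemma conj_trmx_factor (R : realType) (m n p : nat)
    (A : 'M[R[i]]_(m, n)) (B : 'M[R[i]]_(p, n)) :
  mxrange (conj_trmx A) `<=` mxrange (conj_trmx B) -> exists C, A = C *m B.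
Proof.
move=> /mxrange_sub_mulmx[C eqC]; exists (conj_trmx C).
rewrite -[A]trmxCK -/(conj_trmx A) eqC /conj_trmx trmx_mul map_mxM.
by rewrite trmxCK.
Qed.

(** No Neumann series: if [1 + K] is singular, some row [v != 0] satisfies [v K = - v], and
    submultiplicativity contradicts [N K < 1]. *)
Lemma submul_norm_lt1_unitmx (R : realType) (n : nat) (N : 'M[R[i]]_n -> R)
    (K : 'M[R[i]]_n) :
  submultiplicative_norm N -> N K < 1 -> 1%:M + K \in unitmx.
Proof.
move=> hN ltK; rewrite unitmxE unitfE; apply/det0P => -[v v0 eqv].
(* [N] only measures square matrices, so [v] is repeated in every row. *)
pose A : 'M[R[i]]_n := const_mx (m := n) (n := 1) 1 *m v.
have AK : A *m K = (-1) *: A.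
  rewrite scaleN1r; apply/eqP; rewrite -addr_eq0 addrC -{1}[A]mulmx1 -mulmxDr.
  by rewrite -mulmxA eqv mulmx0.
have NA0 : N A = 0.
  have := submul_normM hN A K.
  rewrite AK (submul_normZ hN) normcN Normc.normc1 mul1r -subr_ge0.
  rewrite -{2}[N A]mulr1 -mulrBr => NA_le.
  apply/eqP; rewrite eq_le (submul_norm_ge0 hN) andbT.
  by move: NA_le; rewrite nmulr_lge0 // subr_lt0.
case/negP: v0; apply/eqP/rowP => j.
have := congr1 (fun M : 'M_n => M j j) (submul_norm_eq0 hN NA0).
by rewrite !mxE big_ord1 !mxE mul1r.
Qed.

(** The range of [P] is stable under [T] and contains that of [F], so [(T + F) ^+ k] and [T ^+ k]
    differ by some [P * V]. *)
Lemma fixed_expr_addr (R : pzRingType) (T F P : R) (k : nat) :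
    P * T ^+ k = T ^+ k -> P * F = F -> P * T * P = T * P -> P * P = P ->
  P * (T + F) ^+ k = (T + F) ^+ k.
Proof.
move=> PTk PF PTP PP.
have [V ->] : exists V, (T + F) ^+ k = T ^+ k + P * V.
  elim: k {PTk} => [|k [V eqV]]; first by exists 0; rewrite mulr0 addr0.
  exists (T * P * V + F * (T ^+ k + P * V)).
  rewrite exprS eqV mulrDl mulrDr -exprS -addrA; congr (_ + _).
  by rewrite [RHS]mulrDr !mulrA PTP PF.
by rewrite mulrDr PTk mulrA PP.
Qed.

(** Every [S ^+ i * P] is fixed by [P], so the innermost [Y * S] can be cancelled repeatedly. *)
Lemma left_inverse_expr (R : pzRingType) (S Y P : R) (j : nat) :
    Y * S = P -> P * P = P -> P * S * P = S * P ->
  Y ^+ j * S ^+ j * P = P.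
Proof.
move=> YS PP PSP.
have PSj i : P * (S ^+ i * P) = S ^+ i * P.
  elim: i => [|i IHi]; first by rewrite !mul1r.
  by rewrite exprS -mulrA -IHi !mulrA PSP.
elim: j => [|j IHj]; first by rewrite !mul1r.
by rewrite exprSr exprS -!mulrA (mulrA Y) YS PSj mulrA.
Qed.

(** A criterion that avoids computing the index: [k] may be any exponent, since at the index [l] of
    [S] the power [S ^+ l] factors through [S ^+ (k + l)], which [P] fixes. *)
Lemma min_rank_weighted_weak_Drazin_idem (F : fieldType) (m n k : nat)
    (W : 'M[F]_(n, m)) (A X : 'M[F]_(m, n)) (P : 'M[F]_m) :
    X *m W *m (A *m W) = P -> P *m P = P ->
    P *m (A *m W) *m P = A *m W *m P ->
    P *m (A *m W) ^+ k = (A *m W) ^+ k -> (\rank X <= \rank P)%N ->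
  min_rank_weighted_weak_Drazin W A X.
Proof.
rewrite /min_rank_weighted_weak_Drazin; set S := A *m W => XS PP PSP PSk rkX.
have [Z /(@expr_factor_iter _ _ _ _ k) eqS] := mxind_factor S.
set l := mxind S in eqS *.
have PSl : P *m S ^+ l = S ^+ l.
  by rewrite eqS exprD -!mulmxE !mulmxA PSk.
have XSl : X *m W *m S ^+ l.+1 = S ^+ l.
  by rewrite exprS -mulmxE mulmxA XS.
split=> //; apply/eqP; rewrite eqn_leq; apply/andP; split.
  (* [P = (X W)^l S^l P] bounds the rank of [P] by that of [S ^+ l]. *)
  apply: leq_trans rkX _; rewrite -(left_inverse_expr l XS PP PSP).
  by apply: leq_trans (mxrankM_maxl _ _) (mxrankM_maxr _ _).
by rewrite -XSl -mulmxA mxrankM_maxl.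
Qed.

(** The Woodbury formula supplies the inverse [1 - A (1 + B A)^-1 B]. *)
Lemma unitmx_addM1C (F : fieldType) (m n : nat)
    (A : 'M[F]_(m, n)) (B : 'M[F]_(n, m)) :
  1%:M + B *m A \in unitmx -> 1%:M + A *m B \in unitmx.
Proof.
move=> uBA; suff /mulmx1_unit[] : (1%:M + A *m B) *m
  (1%:M - A *m invmx (1%:M + B *m A) *m B) = 1%:M by [].
rewrite mulmxBr mulmx1 [X in _ - X]mulmxA [X in _ - X *m _]mulmxA.
rewrite (mulmxDl 1%:M (A *m B) A) mul1mx -[A *m B *m A]mulmxA.
by rewrite -{2}[A]mulmx1 -mulmxDr mulmxK // addrK.
Qed.

(** Push-through identity, from [(1 + A B) A = A (1 + B A)]. *)
Lemma invmx_addM1C (F : fieldType) (m n : nat)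
    (A : 'M[F]_(m, n)) (B : 'M[F]_(n, m)) :
  1%:M + B *m A \in unitmx ->
  invmx (1%:M + A *m B) *m A = A *m invmx (1%:M + B *m A).
Proof.
move=> uBA; have uAB := unitmx_addM1C uBA.
apply: (canLR (mulKmx uAB)); rewrite mulmxA mulmxDl mul1mx -(mulmxA A B A).
by rewrite -{2}[A]mulmx1 -mulmxDr mulmxK.
Qed.

Theorem theorem3p17 (R : realType) (m n : nat)
    (N : 'M[R[i]]_n -> R) (hN : submultiplicative_norm N)
    (B : 'M[R[i]]_(m, n)) (W : 'M[R[i]]_(n, m)) (X E D : 'M[R[i]]_(m, n))
    (hX : min_rank_weighted_weak_Drazin W B X)
    (hD : D = B + E)
    (hE : mxrange (E *m W) `<=` mxrange ((B *m W) ^+ mxind (B *m W)))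
    (hE' : mxrange (conj_trmx (E *m W))
             `<=` mxrange (conj_trmx (X *m W *m B *m W)))
    (hEX : N (W *m E *m W *m X) < 1) :
  [/\ 1%:M + W *m E *m W *m X \in unitmx,
      1%:M + X *m W *m E *m W \in unitmx,
      min_rank_weighted_weak_Drazin W D
        (X *m invmx (1%:M + W *m E *m W *m X)),
      X *m invmx (1%:M + W *m E *m W *m X) *m W *m D *m W = X *m W *m B *m W
    & W *m D *m W *m invmx (1%:M + X *m W *m E *m W) *m X = W *m B *m W *m X].
Proof.
have [TkX rkX] := hX; set T := B *m W in hE TkX rkX.
have defT : T = B *m W by []; clearbody T.
set k := mxind T in hE TkX rkX.
have [G eF] := mxrange_sub_mulmx hE.
have [H eF'] := conj_trmx_factor hE'.
have [Z eT] := mxind_factor T; rewrite -/k in eT.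
(* [X] has the rank of [T ^+ k], which is the multiple [X W T^(k+1)] of [X]. *)
have [V eX] : exists V, X = T ^+ k *m V.
  have [|V eV] := @mulmx_eq_rank_factor _ _ _ _ X (W *m T ^+ k.+1).
    by rewrite mulmxA TkX.
  by exists V; rewrite {1}eV mulmxA TkX.
set F := E *m W in eF eF'.
have defF : F = E *m W by []; clearbody F.
pose P := X *m W *m T.
have eP : X *m W *m B *m W = P by rewrite /P defT !mulmxA.
rewrite eP in eF' *.
have PTk : P *m T ^+ k = T ^+ k by rewrite -mulmxA mulmxE -exprS -mulmxE.
have PX : P *m X = X by rewrite {1}eX mulmxA PTk.
have PP : P *m P = P by rewrite {2}/P !mulmxA PX.
have PF : P *m F = F by rewrite eF mulmxA PTk.
have FP : F *m P = F by rewrite eF' -mulmxA PP.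
(* On the range of [T ^+ k], [X W] is also a right inverse of [T]. *)
have TXTk : T *m X *m W *m T ^+ k = T ^+ k.
  by rewrite eT !mulmxA -!(mulmxA T) TkX mulmxA mulmxE -exprS.
have TXF : T *m X *m W *m F = F by rewrite eF mulmxA TXTk.
have PTX : P *m T *m X = T *m X.
  have TTk : T *m T ^+ k = T ^+ k *m T by rewrite !mulmxE -exprS exprSr.
  by rewrite eX !mulmxA -(mulmxA P) TTk mulmxA PTk.
have PTP : P *m T *m P = T *m P by rewrite {2 3}/P !mulmxA PTX.
have uMX := submul_norm_lt1_unitmx hN hEX.
pose M := W *m F.
have eM : W *m E *m W = M by rewrite /M defF mulmxA.
have eXM : X *m W *m E *m W = X *m M by rewrite /M defF !mulmxA.
rewrite eM eXM in uMX *.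
have uXM := unitmx_addM1C uMX.
have eX' := invmx_addM1C uMX.
set X' := X *m invmx _ in eX' *.
have eS : D *m W = T + F by rewrite hD mulmxDl -defT -defF.
(* With [X' = (1 + X M)^-1 X], this amounts to [X W (T + F) = (1 + X M) P], where [F P = F] matches
   the perturbation terms. *)
have XS : X' *m W *m (D *m W) = P.
  rewrite -eX' -!mulmxA; apply: (canLR (mulKmx uXM)).
  rewrite eS mulmxDl mul1mx mulmxDr mulmxDr /P /M -!mulmxA; congr (_ + _).
  by move: FP; rewrite /P -!mulmxA => ->.
(* With [X' = X (1 + M X)^-1], this amounts to [(T + F) X = T X (1 + M X)], which follows from
   [T X W F = F]. *)
have SX : D *m W *m X' = T *m X.
  rewrite /X' mulmxA; apply: (canLR (mulmxK uMX)).
  rewrite eS mulmxDr mulmxDl mulmx1; congr (_ + _).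
  by rewrite /M !mulmxA TXF.
split; [exact: uMX | exact: uXM | | |].
- apply: (@min_rank_weighted_weak_Drazin_idem _ _ _ k _ _ _ P XS PP).
  + by rewrite eS mulmxDr !mulmxDl PTP PF.
  + by rewrite eS; apply: fixed_expr_addr.
  + rewrite -eX'; apply: leq_trans (mxrankM_maxr _ _) _.
    by rewrite rkX -PTk mxrankM_maxl.
- by rewrite -mulmxA XS.
- by rewrite -[LHS]mulmxA eX' -2!mulmxA (mulmxA D) SX defT !mulmxA.
Qed.
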